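(* Fix a time step $k$. Assume that the communication graph $\mathcal{G}$ is undirected and connected. Consider the dual ascent iteration, for $i=1,\dots,N$ and $l=0,1,2,\dots$, started from arbitrary initial vectors $\lambda_{1,0},\dots,\lambda_{N,0}\in\mathbb{R}^n$: $$\xi_{i,l+1}=\hat x_{i,k|k-1}+K_{i,k}(y_{i,k}-H_i\hat x_{i,k|k-1})-\psi_{i,l},$$ $$\lambda_{i,l+1}=\lambda_{i,l}+\alpha_\lambda\sum_{j\in\mathcal{N}_i}a_{ij}(\xi_{i,l+1}-\xi_{j,l+1}),$$ where $$K_{i,k}=\Big(H_i^\top R_i^{-1}H_i+\tfrac1N P_{i,k|k-1}^{-1}\Big)^{-1}H_i^\top R_i^{-1},\qquad \psi_{i,l}=\Big(H_i^\top R_i^{-1}H_i+\tfrac1N P_{i,k|k-1}^{-1}\Big)^{-1}\sum_{j\in\mathcal{N}_i}a_{ij}(\lambda_{i,l}-\lambda_{j,l}).$$ Suppose the step size $\alpha_\lambda>0$ satisfies $$\alpha_\lambda<\frac{2}{\sigma_N^2\,\max_i\big\{\|(\bar H_i^\top\bar S_{i,k}^{-1}\bar H_i)^{-1}\|\big\}},$$ where $\sigma_N$ is the maximum eigenvalue of the graph Laplacian $L$. Then, for every $i$, the sequence $\{\xi_{i,l}\}$ converges, as $l\to\infty$, to the solution $\hat x_k$ of the centralized Kalman-filtering (CKF) problem. Moreover, for every $i$, the sequence $\{\lambda_{i,l}\}$ converges to a vector which (for the given problem data) is uniquely determined by the initial conditions $\lambda_{1,0},\dots,\lambda_{N,0}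$.
   Context: System. $x_{k+1}=Fx_k+w_k$, $y_k=Hx_k+v_k$, with $x_k\in\mathbb{R}^n$, and $N\ge 2$ sensors. Here $y_k=[y_{1,k};\dots;y_{N,k}]\in\mathbb{R}^m$ with $y_{i,k}\in\mathbb{R}^{m_i}$, $\sum_i m_i=m$, and $H=[H_1;\dots;H_N]$ with $H_i\in\mathbb{R}^{m_i\times n}$. The semicolon notation $[A_1;\dots;A_N]$ denotes vertical stacking. The noises are $w_k\sim \mathsf{N}(0,Q)$ and $v_k\sim\mathsf{N}(0,R)$ with $R=\mathrm{diag}(R_1,\dots,R_N)$ (block diagonal), each $R_i$ symmetric positive definite. The pair $(F,H)$ is observable. Predicted quantities. At the given step $k$, $\hat x_{k|k-1}\in\mathbb{R}^n$ is the predicted estimate and $P_{k|k-1}\in\mathbb{R}^{n\times n}$ is the predicted error covariance, symmetric positive definite. Each estimator $i$ holds local predictions $\hat x_{i,k|k-1}$ and $P_{i,k|k-1}$, and it is assumed that $\hat x_{i,k|k-1}=\hat x_{k|k-1}$ and $P_{i,k|k-1}=P_{k|k-1}$ for all $i$. The measurements $y_{i,k}$ are regarded as given vectors. CKF problem. With $z_k=[y_k;\hat x_{k|k-1}]$, $\bar H_c=[H;I_n]$, $S_k=\mathrm{diag}(R,P_{k|k-1})$, the CKF problem is to minimize $f_c(\xi_c)=\frac12(z_k-\bar H_c\xi_c)^\top S_k^{-1}(z_k-\bar H_c\xi_c)$ over $\xi_c\in\mathbb{R}^n$. Its minimizer is $\hat x_k=\hat x_{k|k-1}+K(y_k-H\hat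 x_{k|k-1})$ with $K=(H^\top R^{-1}H+P_{k|k-1}^{-1})^{-1}H^\top R^{-1}$. Local data. $\bar H_i=[H_i;I_n]$ and $\bar S_{i,k}=\mathrm{diag}(R_i,N P_{i,k|k-1})$, so that $\bar H_i^\top\bar S_{i,k}^{-1}\bar H_i=H_i^\top R_i^{-1}H_i+\frac1N P_{i,k|k-1}^{-1}$. $\|\cdot\|$ is the spectral norm. Network. $\mathcal{G}$ is a graph on $N$ nodes with adjacency weights $a_{ij}\ge0$, $a_{ii}=0$, $a_{ij}>0$ iff $i$ and $j$ communicate; undirected means $a_{ij}=a_{ji}$. $\mathcal{N}_i=\{j: a_{ij}>0\}$. $L\in\mathbb{R}^{N\times N}$ is the Laplacian: $l_{ij}=-a_{ij}$ for $i\neq j$, $l_{ii}=\sum_j a_{ij}$. *)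

(* Defs.v *)
(* MathComp-Analysis; the scalars are an arbitrary R : realType. *)
From HB Require Import structures.
From mathcomp Require Import all_boot all_order all_algebra.
From mathcomp Require Import all_classical all_reals all_analysis.

Set Implicit Arguments.
Unset Strict Implicit.
Unset Printing Implicit Defensive.

Import Order.TTheory GRing.Theory Num.Theory.
Import numFieldNormedType.Exports.

Local Open Scope classical_set_scope.
Local Open Scope ring_scope.

Definition possemidefmx (R : realType) (n : nat) (A : 'M[R]_n) : Prop :=
  A^T = A /\ forall v : 'cV[R]_n, 0 <= (v^T *m A *m v) 0 0.

Definition posdefmx (R : realType) (n : nat) (A : 'M[R]_n) : Prop :=
  A^T = A /\ forall v : 'cV[R]_n, v != 0 -> 0 < (v^T *m A *m v) 0 0.

(* The norm `|v| that MathComp-Analysis puts on matrices is the entrywise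
   maximum; the spectral norm is induced by the Euclidean one. *)
Definition enorm (R : realType) (n : nat) (v : 'cV[R]_n) : R :=
  Num.sqrt (\sum_(i < n) v i 0 ^+ 2).

Definition spectral_norm (R : realType) (m n : nat) (A : 'M[R]_(m, n)) : R :=
  sup [set enorm (A *m v) | v in [set v : 'cV[R]_n | enorm v <= 1]].

Definition max_eigenvalue (R : realType) (n : nat) (A : 'M[R]_n) (s : R) :
    Prop :=
  eigenvalue A s /\ forall t : R, eigenvalue A t -> t <= s.

(* Kalman rank condition on [H; H F; ...; H F^(n-1)]. *)
Definition observable (R : realType) (m n : nat)
    (F : 'M[R]_n) (H : 'M[R]_(m, n)) : Prop :=
  \rank (\mxcol_(k < n) (H *m F ^+ k)) = n.

(* Graphs on 'I_N are given by their weights a; i and j communicate iff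
   0 < a i j. *)
Definition weighted_graph (R : realType) (N : nat) (a : 'I_N -> 'I_N -> R) :
    Prop :=
  (forall i j, 0 <= a i j) /\ (forall i, a i i = 0).

Definition undirected (R : realType) (N : nat) (a : 'I_N -> 'I_N -> R) : Prop :=
  forall i j, a i j = a j i.

Definition graph_connected (R : realType) (N : nat) (a : 'I_N -> 'I_N -> R) :
    Prop :=
  forall i j, connect (fun u v : 'I_N => 0 < a u v) i j.

Definition laplacian (R : realType) (N : nat) (a : 'I_N -> 'I_N -> R) :
    'M[R]_N :=
  \matrix_(i, j) if i == j then \sum_(k < N) a i k else - a i j.

Section Centralized.
Variables (R : realType) (m n : nat).
Variables (H : 'M[R]_(m, n)) (V : 'M[R]_m) (P : 'M[R]_n).
Variables (y : 'cV[R]_m) (xpred : 'cV[R]_n).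

Definition ckf_cost (xi : 'cV[R]_n) : R :=
  let z := col_mx y xpred in
  let Hc := col_mx H 1%:M in
  let S := block_mx V 0 0 P in
  2^-1 * ((z - Hc *m xi)^T *m invmx S *m (z - Hc *m xi)) 0 0.

Definition ckf_minimizer (x : 'cV[R]_n) : Prop :=
  forall xi : 'cV[R]_n, ckf_cost x <= ckf_cost xi.

Definition ckf_gain : 'M[R]_(n, m) :=
  invmx (H^T *m invmx V *m H + invmx P) *m H^T *m invmx V.

Definition ckf_estimate : 'cV[R]_n := xpred + ckf_gain *m (y - H *m xpred).

End Centralized.

Section Local.
Variables (R : realType) (N mi n : nat).
Variables (Hi : 'M[R]_(mi, n)) (Vi : 'M[R]_mi) (Pi : 'M[R]_n).

Definition Hbar : 'M[R]_(mi + n, n) := col_mx Hi 1%:M.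

Definition Sbar : 'M[R]_(mi + n) := block_mx Vi 0 0 (N%:R *: Pi).

Definition local_info : 'M[R]_n :=
  Hi^T *m invmx Vi *m Hi + N%:R^-1 *: invmx Pi.

Definition local_gain : 'M[R]_(n, mi) :=
  invmx local_info *m Hi^T *m invmx Vi.

End Local.

Definition step_bound (R : realType) (N n : nat) (m_ : 'I_N -> nat)
    (H : forall i, 'M[R]_(m_ i, n)) (V : forall i, 'M[R]_(m_ i))
    (Ploc : 'I_N -> 'M[R]_n) (sigma : R) : R :=
  2 / (sigma ^+ 2 *
       \big[Num.max/0]_(i < N)
         spectral_norm
           (invmx ((Hbar (H i))^T *m invmx (Sbar N (V i) (Ploc i))
                   *m Hbar (H i)))).

(* xi i 0 is not part of the algorithm and is left unconstrained. *)
Definition dual_ascent (R : realType) (N n : nat) (m_ : 'I_N -> nat)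
    (a : 'I_N -> 'I_N -> R)
    (H : forall i, 'M[R]_(m_ i, n)) (V : forall i, 'M[R]_(m_ i))
    (Ploc : 'I_N -> 'M[R]_n) (xloc : 'I_N -> 'cV[R]_n)
    (y : forall i, 'cV[R]_(m_ i)) (alpha : R)
    (xi lam : 'I_N -> nat -> 'cV[R]_n) : Prop :=
  (forall i l,
     xi i l.+1 =
       xloc i + local_gain N (H i) (V i) (Ploc i) *m (y i - H i *m xloc i)
       - invmx (local_info N (H i) (V i) (Ploc i)) *m
           (\sum_(j < N | 0 < a i j) a i j *: (lam i l - lam j l))) /\
  (forall i l,
     lam i l.+1 =
       lam i l +
       alpha *: \sum_(j < N | 0 < a i j) a i j *: (xi i l.+1 - xi j l.+1)).

(* Main.v *)
Require Import Defs.
From HB Require Import structures.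
From mathcomp Require Import all_boot all_order all_algebra.
From mathcomp Require Import all_classical all_reals all_analysis.
From mathcomp Require Import ring lra.

Import Order.TTheory GRing.Theory Num.Theory.
Import numFieldNormedType.Exports.

Local Open Scope classical_set_scope.
Local Open Scope ring_scope.

Set Implicit Arguments.
Unset Strict Implicit.
Unset Printing Implicit Defensive.

(** Stack the [N] local vectors into one vector. With [K = L (x) I], [A_i] the
    local information matrices, [D = diag(A_i^-1)] and [c] the stacked local
    estimates, the iteration reads [xi = c - D K lam],
    [lam+ = lam + alpha K xi]; that is, gradient ascent on a concave quadratic
    with Hessian [- M], where [M = K D K].

    Convergence of [lam]. Let [s] be the largest eigenvalue of the Laplacian and
    [d = max_i |A_i^-1|]. The Rayleigh bound [quadform_le_max_eigenvalue] and
    the Loewner inequality [A^2 <= d A] for [0 <= A <= d I]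
    ([psd_sqnorm_le]) give [|M v|^2 <= s^2 d <v, M v>], and the step size
    condition says [alpha s^2 d < 2]. As [ker M = ker K], the equation
    [M lam = K c] is solvable; as [M] is symmetric, some solution differs from
    the initial [lam0] by a vector [M g] ([dual_optimum]). This solution
    [lam0 - M g] depends on [lam0] alone, and the error keeps the form [M g_l],
    with [|g_l|^2] decreasing by at least a multiple of [<g_l, M g_l>]; hence
    the error tends to 0 ([gradient_iteration_cvg]).

    Identification of the limit of [xi]. It satisfies [K xi = 0], so connectivity
    makes all its blocks equal to one vector [x] ([blockwise_laplacian_ker]).
    Summing [A_i x = A_i c_i - (K lam)_i] over the nodes cancels the multipliers,
    because the columns of [L] sum to 0, and leaves
    [(sum_i A_i) x = sum_i A_i c_i]. The centralized estimate solves the same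
    equation ([ckf_estimate_fusion]), and [sum_i A_i] is invertible. That this
    estimate is the only minimiser of the centralized cost is completion of the
    square ([ckf_minimizer_estimate]). *)

(** * Dot products *)

Definition dotv (R : realType) (n : nat) (u v : 'cV[R]_n) : R :=
  (u^T *m v) 0 0.

Definition sqnorm (R : realType) (n : nat) (v : 'cV[R]_n) : R := dotv v v.

Section DotProduct.
Variables (R : realType).

Lemma dotvE n (u v : 'cV[R]_n) : dotv u v = \sum_i u i 0 * v i 0.
Proof. by rewrite /dotv mxE; apply: eq_bigr => i _; rewrite mxE. Qed.

Lemma dotvC n (u v : 'cV[R]_n) : dotv u v = dotv v u.
Proof. by rewrite !dotvE; apply: eq_bigr => i _; rewrite mulrC. Qed.

Lemma dotvDr n (u v w : 'cV[R]_n) : dotv u (v + w) = dotv u v + dotv u w.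
Proof. by rewrite /dotv mulmxDr mxE. Qed.

Lemma dotvZr n (u : 'cV[R]_n) t v : dotv u (t *: v) = t * dotv u v.
Proof. by rewrite /dotv -scalemxAr mxE. Qed.

Lemma dotvNr n (u v : 'cV[R]_n) : dotv u (- v) = - dotv u v.
Proof. by rewrite -scaleN1r dotvZr mulN1r. Qed.

Lemma dotvDl n (u v w : 'cV[R]_n) : dotv (v + w) u = dotv v u + dotv w u.
Proof. by rewrite dotvC dotvDr !(dotvC u). Qed.

Lemma dotvZl n (u : 'cV[R]_n) t v : dotv (t *: v) u = t * dotv v u.
Proof. by rewrite dotvC dotvZr (dotvC u). Qed.

Lemma dotvNl n (u v : 'cV[R]_n) : dotv (- v) u = - dotv v u.
Proof. by rewrite dotvC dotvNr (dotvC u). Qed.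

Definition dotv_lin := (dotvDl, dotvDr, dotvZl, dotvZr, dotvNl, dotvNr).

Lemma dotv_mull m n (A : 'M[R]_(m, n)) u v :
  dotv (A *m u) v = dotv u (A^T *m v).
Proof. by rewrite /dotv trmx_mul mulmxA. Qed.

Lemma quadformE n (A : 'M[R]_n) (v : 'cV[R]_n) :
  (v^T *m A *m v) 0 0 = dotv v (A *m v).
Proof. by rewrite /dotv mulmxA. Qed.

Lemma sqnorm_sum n (v : 'cV[R]_n) : sqnorm v = \sum_i v i 0 ^+ 2.
Proof. by rewrite /sqnorm dotvE; apply: eq_bigr => i _; rewrite expr2. Qed.

Lemma sqnorm_ge0 n (v : 'cV[R]_n) : 0 <= sqnorm v.
Proof. by rewrite sqnorm_sum; apply: sumr_ge0 => i _; exact: sqr_ge0. Qed.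

Lemma le_sqnorm n (v : 'cV[R]_n) i : v i 0 ^+ 2 <= sqnorm v.
Proof.
rewrite sqnorm_sum (bigD1 i)//= lerDl.
by apply: sumr_ge0 => j _; exact: sqr_ge0.
Qed.

Lemma sqnorm_eq0 n (v : 'cV[R]_n) : (sqnorm v == 0) = (v == 0).
Proof.
apply/idP/eqP => [/eqP v0|->]; last by rewrite /sqnorm /dotv mulmx0 mxE.
apply/matrixP => i j; rewrite (ord1 j) mxE; apply/eqP.
by rewrite -sqrf_eq0 eq_le sqr_ge0 andbT -v0 le_sqnorm.
Qed.

Lemma sqnormN n (v : 'cV[R]_n) : sqnorm (- v) = sqnorm v.
Proof. by rewrite /sqnorm !dotv_lin opprK. Qed.

Lemma sqnorm_gt0 n (v : 'cV[R]_n) : (0 < sqnorm v) = (v != 0).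
Proof. by rewrite lt_def sqnorm_ge0 andbT sqnorm_eq0. Qed.

End DotProduct.

(** * Semidefinite forms *)

Section Semidefinite.
Variables (R : realType) (n : nat).
Implicit Types (A B : 'M[R]_n) (u v : 'cV[R]_n).

Lemma psdP A : A^T = A -> (forall v, 0 <= dotv v (A *m v)) -> possemidefmx A.
Proof. by move=> sA pA; split=> // v; rewrite quadformE. Qed.

Lemma psd_ge0 A v : possemidefmx A -> 0 <= dotv v (A *m v).
Proof. by case=> _ /(_ v); rewrite quadformE. Qed.

Lemma pd_gt0 A v : posdefmx A -> v != 0 -> 0 < dotv v (A *m v).
Proof. by case=> _ /(_ v) + v0; rewrite quadformE; apply. Qed.

Lemma pdP A :
  A^T = A -> (forall v, v != 0 -> 0 < dotv v (A *m v)) -> posdefmx A.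
Proof. by move=> sA pA; split=> // v; rewrite quadformE; apply: pA. Qed.

Lemma pd_psd A : posdefmx A -> possemidefmx A.
Proof.
move=> pA; apply: psdP; first by case: pA.
move=> v; have [->|v0] := eqVneq v 0; last by exact/ltW/pd_gt0.
by rewrite mulmx0 /dotv mulmx0 mxE.
Qed.

Lemma pd1 : posdefmx (1%:M : 'M[R]_n).
Proof.
by apply: pdP => [|v v0]; rewrite ?trmx1// mul1mx -/(sqnorm v) sqnorm_gt0.
Qed.

(** The discriminant argument, in the division-free form that also covers a
    degenerate direction [v]: the form is evaluated at [s u - t v]. *)
Lemma psd_cauchy_schwarz A u v : possemidefmx A ->
  dotv u (A *m v) ^+ 2 <= dotv u (A *m u) * dotv v (A *m v).
Proof.
move=> pA; have sA : A^T = A by case: pA.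
set a := dotv u (A *m u); set b := dotv u _; set c := dotv v _.
have vu : dotv v (A *m u) = b by rewrite dotvC dotv_mull sA.
have quad s t : 0 <= s ^+ 2 * a - 2 * s * t * b + t ^+ 2 * c.
  have := psd_ge0 (s *: u - t *: v) pA.
  rewrite mulmxDr mulmxN -!scalemxAr !dotv_lin vu -/a -/b -/c.
  by lra.
have a0 : 0 <= a by exact: psd_ge0.
have : 0 <= c by exact: psd_ge0.
rewrite le_eqVlt => /orP[/eqP c0|c0].
  have [->|b0] := eqVneq b 0; first by rewrite -c0 mulr0 expr0n.
  have b2 : 0 < b ^+ 2 by rewrite exprn_even_gt0.
  have := quad 1 ((a + 1) / (2 * b)); rewrite -c0.
  have -> : 1 ^+ 2 * a - 2 * 1 * ((a + 1) / (2 * b)) * b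
           + ((a + 1) / (2 * b)) ^+ 2 * 0 = -1 by field.
  by lra.
have := quad c b.
have -> : c ^+ 2 * a - 2 * c * b * b + b ^+ 2 * c = c * (a * c - b ^+ 2).
  by ring.
by rewrite pmulr_rge0// subr_ge0.
Qed.

Lemma dotv_cauchy_schwarz u v : dotv u v ^+ 2 <= sqnorm u * sqnorm v.
Proof.
by have := psd_cauchy_schwarz u v (pd_psd pd1); rewrite !mul1mx.
Qed.

(** For a symmetric positive semidefinite [A] with largest eigenvalue at most
    [d], [A^2 <= d A] in the Loewner order: apply Cauchy-Schwarz for the form of
    [A] to [v] and [A v]. *)
Lemma psd_sqnorm_le A d v : possemidefmx A ->
  (forall w, dotv w (A *m w) <= d * sqnorm w) ->
  sqnorm (A *m v) <= d * dotv v (A *m v).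
Proof.
move=> pA dA; have sA : A^T = A by case: pA.
have := psd_cauchy_schwarz v (A *m v) pA.
have -> : dotv v (A *m (A *m v)) = sqnorm (A *m v).
  by rewrite /sqnorm dotv_mull sA.
have q0 := psd_ge0 v pA; have := dA (A *m v).
have := sqnorm_ge0 (A *m v).
set s := sqnorm _; set q := dotv v _ in q0 *; set r := dotv _ _.
rewrite le_eqVlt => /orP[/eqP s0|s0] le_r le_s.
  have [v0|v0] := eqVneq v 0.
    by rewrite -s0 /q v0 mulmx0 /dotv mulmx0 mxE mulr0.
  have : 0 <= d * sqnorm v by exact: le_trans q0 (dA v).
  by rewrite pmulr_lge0 ?sqnorm_gt0// -s0 => d0; exact: mulr_ge0.
rewrite -(ler_pM2r s0) -expr2; apply: le_trans le_s _.
by apply: le_trans (ler_wpM2l q0 le_r) _; rewrite mulrA (mulrC q).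
Qed.

Lemma psd_ker A v : possemidefmx A -> dotv v (A *m v) = 0 -> A *m v = 0.
Proof.
move=> pA q0; apply/eqP; rewrite -sqnorm_eq0 eq_le sqnorm_ge0 andbT.
have sA : A^T = A by case: pA.
have := psd_cauchy_schwarz v (A *m v) pA; rewrite q0 mul0r.
rewrite -{1}sA -dotv_mull -/(sqnorm _) => h.
have : sqnorm (A *m v) ^+ 2 = 0 by apply/eqP; rewrite eq_le h sqr_ge0.
by move/eqP; rewrite sqrf_eq0 => /eqP->.
Qed.

(** By [psd_ker], a semidefinite form vanishes only on the kernel. *)
Lemma pd_of_psd_unit A : possemidefmx A -> A \in unitmx -> posdefmx A.
Proof.
move=> pA uA; apply: pdP => [|v v0]; first by case: pA.
rewrite lt_def psd_ge0// andbT; apply: contraNneq v0 => q0.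
by rewrite -(mulKmx uA v) (psd_ker pA q0) mulmx0.
Qed.

Lemma unitmx_of_ker0 A : (forall v, A *m v = 0 -> v = 0) -> A \in unitmx.
Proof.
move=> kA; rewrite -unitmx_tr -row_free_unit -kermx_eq0.
apply/eqP/row_matrixP => i; rewrite row0 -[LHS]trmxK.
rewrite (kA (row i (kermx A^T))^T) ?trmx0//.
by apply: trmx_inj; rewrite trmx_mul trmxK -row_mul mulmx_ker row0 trmx0.
Qed.

Lemma pd_unit A : posdefmx A -> A \in unitmx.
Proof.
move=> pA; apply: unitmx_of_ker0 => v Av0; apply/eqP/negP => /negP v0.
by have := pd_gt0 pA v0; rewrite Av0 /dotv mulmx0 mxE ltxx.
Qed.

Lemma pd_inv A : posdefmx A -> posdefmx (invmx A).
Proof.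
move=> pA; have uA := pd_unit pA; have sA : A^T = A by case: pA.
apply: pdP => [|v v0]; first by rewrite trmx_inv sA.
rewrite -{1}(mulKVmx uA v) dotv_mull sA pd_gt0//.
by apply: contraNneq v0 => w0; rewrite -(mulKVmx uA v) w0 mulmx0.
Qed.

End Semidefinite.

(** * Norm bounds *)

Section NormBounds.
Variables (R : realType).

(** Row by row Cauchy-Schwarz, which yields the squared Frobenius norm as
    constant; the added 1 makes it positive also when [A = 0]. *)
Lemma sqnorm_mulmx_bound m n (A : 'M[R]_(m, n)) :
  exists2 C, 0 < C & forall v, sqnorm (A *m v) <= C * sqnorm v.
Proof.
exists (1 + \sum_i sqnorm (row i A)^T) => [|v].
  by apply: ltr_pwDl => //; apply: sumr_ge0 => i _; exact: sqnorm_ge0.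
rewrite mulrDl mul1r -[leLHS]add0r lerD ?sqnorm_ge0// sqnorm_sum mulr_suml.
apply: ler_sum => i _.
have -> : (A *m v) i 0 = dotv (row i A)^T v.
  by rewrite /dotv trmxK -row_mul [RHS]mxE.
exact: dotv_cauchy_schwarz.
Qed.

Lemma enormE n (v : 'cV[R]_n) : enorm v = Num.sqrt (sqnorm v).
Proof. by rewrite /enorm sqnorm_sum. Qed.

Lemma sqr_enorm n (v : 'cV[R]_n) : enorm v ^+ 2 = sqnorm v.
Proof. by rewrite enormE sqr_sqrtr// sqnorm_ge0. Qed.

Lemma enorm_ge0 n (v : 'cV[R]_n) : 0 <= enorm v.
Proof. exact: sqrtr_ge0. Qed.

Lemma enormZ n t (v : 'cV[R]_n) : enorm (t *: v) = `|t| * enorm v.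
Proof.
rewrite !enormE /sqnorm !dotv_lin mulrA -expr2 sqrtrM ?sqr_ge0//.
by rewrite sqrtr_sqr.
Qed.

Lemma spectral_norm_ub m n (A : 'M[R]_(m, n)) v :
  enorm v <= 1 -> enorm (A *m v) <= spectral_norm A.
Proof.
move=> v1; apply: ub_le_sup; last by exists v.
have [C C0 AC] := sqnorm_mulmx_bound A; exists (Num.sqrt C) => _ [w w1 <-].
rewrite enormE ler_sqrt ?sqnorm_ge0//; last exact: ltW.
apply: le_trans (AC w) _; rewrite -[leRHS]mulr1 ler_pM2l// -sqr_enorm.
by rewrite expr_le1// enorm_ge0.
Qed.

Lemma enorm_mulmx_le m n (A : 'M[R]_(m, n)) v :
  enorm (A *m v) <= spectral_norm A * enorm v.
Proof.
have [->|v0] := eqVneq v 0.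
  suff e0 p : enorm (0 : 'cV[R]_p) = 0 by rewrite mulmx0 !e0 mulr0.
  by rewrite enormE; apply/eqP; rewrite sqrtr_eq0 le_eqVlt sqnorm_eq0 eqxx.
have ev : 0 < enorm v by rewrite enormE sqrtr_gt0 sqnorm_gt0.
have iv : 0 <= (enorm v)^-1 by rewrite invr_ge0 ltW.
rewrite -ler_pdivrMr// mulrC -[X in X * _]ger0_norm// -enormZ scalemxAr.
by rewrite spectral_norm_ub// enormZ ger0_norm// mulVf ?gt_eqF.
Qed.

Lemma spectral_norm_ge0 m n (A : 'M[R]_(m, n)) : 0 <= spectral_norm A.
Proof.
apply: le_trans (enorm_ge0 (A *m 0)) (spectral_norm_ub _ _).
rewrite enormE; have -> : sqnorm (0 : 'cV[R]_n) = 0.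
  by apply/eqP; rewrite sqnorm_eq0.
by rewrite sqrtr0 ler01.
Qed.

Lemma quadform_le_spectral_norm n (A : 'M[R]_n) v :
  dotv v (A *m v) <= spectral_norm A * sqnorm v.
Proof.
have le_abs : `|dotv v (A *m v)| <= enorm v * enorm (A *m v).
  rewrite -ler_sqr ?nnegrE ?normr_ge0 ?mulr_ge0 ?enorm_ge0//.
  by rewrite exprMn !sqr_enorm real_normK ?num_real// dotv_cauchy_schwarz.
apply: le_trans (ler_norm _) (le_trans le_abs _).
rewrite -sqr_enorm expr2 mulrA [leRHS]mulrC ler_wpM2l ?enorm_ge0//.
exact: enorm_mulmx_le.
Qed.

End NormBounds.

(** * The largest eigenvalue of a symmetric matrix *)

Lemma sym_eigenvalueP (R : realType) n (A : 'M[R]_n) t : A^T = A ->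
  eigenvalue A t <-> exists2 v : 'cV[R]_n, A *m v = t *: v & v != 0.
Proof.
move=> sA; split.
  case/eigenvalueP => v vA v0; exists v^T; last by rewrite trmx_eq0.
  by rewrite -{1}sA -trmx_mul vA linearZ.
case=> v Av v0; apply/eigenvalueP; exists v^T; last by rewrite trmx_eq0.
by rewrite -{1}sA -trmx_mul Av linearZ.
Qed.

(** The Rayleigh bound. Let [t0] be the infimum of the [t] such that [t I - A]
    is positive semidefinite. If [t0 I - A] were invertible it would be
    positive definite with a uniform lower bound, and [t0] could be decreased;
    hence [t0] is an eigenvalue, so [t0 <= s]. *)
Lemma quadform_le_max_eigenvalue (R : realType) n (A : 'M[R]_n) s v :
  A^T = A -> max_eigenvalue A s -> dotv v (A *m v) <= s * sqnorm v.
Proof.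
move=> sA [/(sym_eigenvalueP _ sA)[w Aw w0] maxs].
pose T := [set t : R | forall u, dotv u (A *m u) <= t * sqnorm u].
have T0 : T !=set0.
  by exists (spectral_norm A) => u; exact: quadform_le_spectral_norm.
have lbT : lbound T s.
  move=> t /(_ w); rewrite Aw dotvZr -/(sqnorm w).
  by rewrite ler_pM2r// sqnorm_gt0.
have hinf : has_inf T by split => //; exists s.
set t0 := inf T.
have Tt0 : T t0.
  move=> u; have [->|u0] := eqVneq u 0.
    have /eqP sq0 : sqnorm (0 : 'cV[R]_n) == 0 by rewrite sqnorm_eq0.
    by rewrite mulmx0 -/(sqnorm _) sq0 mulr0.
  rewrite -ler_pdivrMr ?sqnorm_gt0//; apply: lb_le_inf => // t /(_ u).
  by rewrite -ler_pdivrMr ?sqnorm_gt0.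
suff /maxs le_t0s : eigenvalue A t0.
  by apply: le_trans (Tt0 v) _; rewrite ler_wpM2r// sqnorm_ge0.
(* With C = |B^-1| + 1, B >= C^-1 I; so t0 - C^-1 would also be in T. *)
pose B := t0%:M - A.
have BE u : B *m u = t0 *: u - A *m u by rewrite mulmxBl mul_scalar_mx.
have qB u : dotv u (B *m u) = t0 * sqnorm u - dotv u (A *m u).
  by rewrite BE !dotv_lin.
have pB : possemidefmx B.
  by apply: psdP => [|u]; rewrite ?qB ?subr_ge0// linearB/= tr_scalar_mx sA.
apply/(sym_eigenvalueP _ sA); apply: contrapT => noeig.
have uB : B \in unitmx.
  apply: unitmx_of_ker0 => u /eqP; rewrite BE subr_eq0 => /eqP Au.
  by apply/eqP/negP => /negP u0; apply: noeig; exists u.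
have pBV := pd_psd (pd_inv (pd_of_psd_unit pB uB)).
pose C := spectral_norm (invmx B) + 1.
have C0 : 0 < C by rewrite ltr_wpDl// spectral_norm_ge0.
have lowB u : sqnorm u <= C * dotv u (B *m u).
  have := psd_sqnorm_le (B *m u) pBV (quadform_le_spectral_norm (invmx B)).
  rewrite mulKmx// dotvC => /le_trans; apply.
  by rewrite ler_wpM2r ?psd_ge0// lerDl.
have : T (t0 - C^-1).
  move=> u; have := lowB u; rewrite qB mulrBl -ler_pdivrMl// => le_u.
  by lra.
by move/(ge_inf hinf.2); rewrite -/t0 lerBrDr gerDl invr_le0 leNgt C0.
Qed.

Lemma max_eigenvalue_ge0 (R : realType) n (A : 'M[R]_n) s :
  possemidefmx A -> max_eigenvalue A s -> 0 <= s.
Proof.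
move=> pA [/(sym_eigenvalueP _ pA.1)[w Aw w0] _].
have := psd_ge0 w pA; rewrite Aw dotvZr -/(sqnorm w).
by rewrite pmulr_lge0// sqnorm_gt0.
Qed.

(** * Gradient iterations for a semidefinite system *)

(** The kernel condition makes the rows of [L] vanish on the cokernel of [M], so
    they lie in its row space. *)
Lemma ker_factor (F : fieldType) m n p (L : 'M[F]_(m, n)) (M : 'M[F]_(p, n)) :
  (forall v : 'cV[F]_n, M *m v = 0 -> L *m v = 0) -> exists X, L = X *m M.
Proof.
move=> kerLM; suff /submxP : (L <= M)%MS by [].
rewrite submxE; apply/eqP/matrixP => i j.
have -> : (L *m cokermx M) i j = (L *m col j (cokermx M)) i 0.
  by rewrite colE mulmxA -colE [RHS]mxE.
by rewrite kerLM ?mxE// colE mulmxA mulmx_coker mul0mx.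
Qed.

Lemma sym_ker_factor (F : fieldType) n (L M : 'M[F]_n) :
  L^T = L -> M^T = M ->
  (forall v : 'cV[F]_n, M *m v = 0 -> L *m v = 0) -> exists X, L = M *m X.
Proof.
move=> sL sM /ker_factor[X LX]; exists X^T.
by rewrite -{1}sL LX trmx_mul sM.
Qed.

(** The space is the sum of the kernel and the range of a symmetric [M], since
    [M^2] and [M] have the same kernel; so the distance from a starting point
    [e0] to the solution set of [M e = b] can be covered by a vector of the
    range. *)
Lemma range_correction (R : realType) n (M : 'M[R]_n) (e0 c : 'cV[R]_n) :
  M^T = M -> exists g, M *m (e0 - M *m g) = M *m c.
Proof.
move=> sM; have [||v MMv|X MX] := @sym_ker_factor R n M (M *m M).
- exact: sM.
- by rewrite trmx_mul sM.
- apply/eqP; rewrite -sqnorm_eq0 /sqnorm dotv_mull sM mulmxA MMv.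
  by rewrite /dotv mulmx0 mxE.
exists (X *m (e0 - c)); rewrite mulmxBr !mulmxA -MX mulmxBr.
by rewrite opprB addrCA subrr addr0.
Qed.

(** The error stays of the form [M g_l], where [g_l] follows the homogeneous
    iteration. The squares [|g_l|^2] decrease by at least
    [alpha (2 - alpha mu) <g_l, M g_l>], so these forms tend to 0, and they
    control the error [|M g_l|^2]. *)
Lemma gradient_iteration_cvg (R : realType) n (M : 'M[R]_n) (mu alpha : R)
    (b g : 'cV[R]_n) (e : nat -> 'cV[R]_n) :
  possemidefmx M ->
  (forall v, sqnorm (M *m v) <= mu * dotv v (M *m v)) ->
  0 < alpha -> alpha * mu < 2 ->
  (forall l, e l.+1 = e l + alpha *: (b - M *m e l)) ->
  M *m (e 0%N - M *m g) = b ->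
  sqnorm (e l - (e 0%N - M *m g)) @[l --> \oo] --> 0.
Proof.
move=> pM Mmu alpha0 alphamu eS; set x := e 0%N - _ => Mx.
pose G l := iter l (fun h => h - alpha *: (M *m h)) g.
have eG l : e l - x = M *m G l.
  elim: l => [|l IH]; first by rewrite opprB addrCA subrr addr0.
  rewrite eS addrAC IH -Mx -mulmxBr -opprB IH /= mulmxBr -scalemxAr.
  by rewrite mulmxN scalerN.
pose q l := dotv (G l) (M *m G l).
have q0 l : 0 <= q l by exact: psd_ge0.
pose k := alpha * (2 - alpha * mu).
have k0 : 0 < k by rewrite mulr_gt0// subr_gt0.
have decr l : k * q l <= sqnorm (G l) - sqnorm (G l.+1).
  have := ler_wpM2l (sqr_ge0 alpha) (Mmu (G l)).
  rewrite /= /sqnorm !dotv_lin (dotvC (M *m G l) (G l)) -/(q l).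
  rewrite -/(sqnorm (M *m G l)) /k.
  by move=> h; lra.
have sqG : cvgn (fun l => sqnorm (G l)).
  apply: nonincreasing_is_cvgn.
    apply/nonincreasing_seqP => l; rewrite -subr_ge0.
    by apply: le_trans (decr l); rewrite mulr_ge0// ltW.
  by exists 0 => _ [l _ <-]; exact: sqnorm_ge0.
have diff0 : (sqnorm (G l) - sqnorm (G l.+1)) @[l --> \oo] --> 0.
  rewrite -(subrr (limn (fun l => sqnorm (G l)))); apply: cvgB => //.
  by rewrite (cvg_shiftS (fun l => sqnorm (G l))).
have up0 :
    (`|mu| * (k^-1 * (sqnorm (G l) - sqnorm (G l.+1)))) @[l --> \oo] --> 0.
  rewrite -(mulr0 (`|mu|)) -(mulr0 (k^-1)).
  by apply: cvgMr; apply: cvgMr.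
apply: squeeze_cvgr (cvg_cst 0) up0; near=> l.
rewrite eG sqnorm_ge0/=; apply: le_trans (Mmu _) _; rewrite -/(q l).
apply: le_trans (ler_wpM2r (q0 l) (ler_norm mu)) _; rewrite ler_wpM2l//.
by rewrite ler_pdivlMl.
Unshelve. all: by end_near. Qed.

Lemma cvg_of_sqnorm (R : realType) n (u : nat -> 'cV[R]_n) x :
  sqnorm (u l - x) @[l --> \oo] --> 0 -> u l @[l --> \oo] --> x.
Proof.
move=> ux; apply/cvgrPdist_le => eps eps0.
have e2 : 0 < eps ^+ 2 by exact: exprn_gt0.
have /cvgrPdist_le /(_ _ e2) := ux; apply: filterS => l.
rewrite sub0r normrN ger0_norm ?sqnorm_ge0// => le_l.
rewrite [leLHS]/Num.Def.normr/= mx_normrE (bigmax_le _ (ltW eps0))//= => -[i j] _.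
rewrite (ord1 j)/= -ler_sqr ?nnegrE ?normr_ge0 ?(ltW eps0)// real_normK ?num_real//.
apply: le_trans _ le_l; apply: le_trans _ (le_sqnorm _ i).
by rewrite !mxE -sqrrN opprB.
Qed.

Lemma sqnorm_mulmx_cvg0 (R : realType) m n (A : 'M[R]_(m, n))
    (u : nat -> 'cV[R]_n) :
  sqnorm (u l) @[l --> \oo] --> 0 -> sqnorm (A *m u l) @[l --> \oo] --> 0.
Proof.
move=> u0; have [C C0 AC] := sqnorm_mulmx_bound A.
have Cu0 : (C * sqnorm (u l)) @[l --> \oo] --> 0.
  by rewrite -(mulr0 C); apply: cvgMr.
apply: squeeze_cvgr (cvg_cst 0) Cu0; near=> l.
by rewrite sqnorm_ge0/=.
Unshelve. all: by end_near. Qed.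

(** * Stacked vectors and block matrices *)

Section Stacked.
Variables (R : realType) (N : nat).

Lemma mxcolZ n (t : R) (u : 'I_N -> 'cV[R]_n) :
  \mxcol_(i < N) (t *: u i) = t *: \mxcol_(i < N) u i.
Proof. by apply/matrixP => i j; rewrite !mxE. Qed.

Lemma dotv_mxcol (p : 'I_N -> nat) (u v : forall i, 'cV[R]_(p i)) :
  dotv (\mxcol_i u i) (\mxcol_i v i) = \sum_i dotv (u i) (v i).
Proof. by rewrite /dotv tr_mxcol mul_mxrow_mxcol summxE. Qed.

Lemma sqnorm_submxcol_cvg0 (p : 'I_N -> nat)
    (u : nat -> 'cV[R]_(\sum_i p i)) i :
  sqnorm (u l) @[l --> \oo] --> 0 ->
  sqnorm (submxcol (u l) i) @[l --> \oo] --> 0.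
Proof.
move=> u0; apply: squeeze_cvgr (cvg_cst 0) u0; near=> l.
rewrite sqnorm_ge0/= -[in leRHS](submxcolK (u l)) /sqnorm dotv_mxcol.
rewrite (bigD1 i)//= lerDl sumr_ge0// => j _; exact: sqnorm_ge0.
Unshelve. all: by end_near. Qed.

Lemma mxdiag_mulV (p : 'I_N -> nat) (A : forall i, 'M[R]_(p i)) :
  (forall i, A i \in unitmx) ->
  \mxdiag_i A i *m \mxdiag_i invmx (A i) = 1%:M.
Proof.
move=> uA; rewrite -mxdiagZ {2 3}/mxdiag mul_mxdiag_mxblock.
apply: eq_mxblock => i j; case: eqVneq => [<-|_]; last by rewrite mulmx0.
by rewrite !conform_mx_id mulmxV.
Qed.

Lemma invmx_mxdiag (p : 'I_N -> nat) (A : forall i, 'M[R]_(p i)) :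
  (forall i, A i \in unitmx) ->
  invmx (\mxdiag_i A i) = \mxdiag_i invmx (A i).
Proof.
move=> uA; have AV := mxdiag_mulV uA; have [uD _] := mulmx1_unit AV.
by rewrite -[LHS]mulmx1 -AV mulKmx.
Qed.

Lemma quadform_mxdiag (p : 'I_N -> nat) (A : forall i, 'M[R]_(p i)) v :
  dotv v (\mxdiag_i A i *m v) =
  \sum_i dotv (submxcol v i) (A i *m submxcol v i).
Proof. by rewrite -{1 2}(submxcolK v) mul_mxdiag_mxcol dotv_mxcol. Qed.

Lemma pd_mxdiag (p : 'I_N -> nat) (A : forall i, 'M[R]_(p i)) :
  (forall i, posdefmx (A i)) -> posdefmx (\mxdiag_i A i).
Proof.
move=> pA; apply: pd_of_psd_unit.
  apply: psdP => [|v].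
    by rewrite tr_mxdiag; apply: eq_mxdiag => i; case: (pA i).
  rewrite quadform_mxdiag sumr_ge0// => i _; exact/psd_ge0/pd_psd.
by have [] := mulmx1_unit (mxdiag_mulV (fun i => pd_unit (pA i))).
Qed.

(** The Kronecker product of [L] with the identity of size [n]. *)
Definition blockwise (n : nat) (L : 'M[R]_N) :=
  \mxblock_(i < N, j < N) ((L i j)%:M : 'M[R]_n).

(** The values of a stacked vector at coordinate [k], one per node; on each
    such slice [blockwise L] acts as [L]. *)
Definition slice (n : nat) (u : 'I_N -> 'cV[R]_n) (k : 'I_n) : 'cV[R]_N :=
  \col_i u i k 0.

Lemma mul_blockwise n (L : 'M[R]_N) (u : 'I_N -> 'cV[R]_n) :
  blockwise n L *m \mxcol_i u i = \mxcol_i \sum_j L i j *: u j.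
Proof.
rewrite mul_mxblock_mxrow; apply: eq_mxcol => i.
by apply: eq_bigr => j _; rewrite mul_scalar_mx.
Qed.

Lemma tr_blockwise n (L : 'M[R]_N) : (blockwise n L)^T = blockwise n L^T.
Proof.
by rewrite tr_mxblock; apply: eq_mxblock => i j; rewrite tr_scalar_mx mxE.
Qed.

Lemma slice_blockwise n (L : 'M[R]_N) (u : 'I_N -> 'cV[R]_n) k :
  slice (fun i => \sum_j L i j *: u j) k = L *m slice u k.
Proof.
apply/matrixP => i j; rewrite !mxE summxE.
by apply: eq_bigr => h _; rewrite !mxE.
Qed.

Lemma dotv_slice n (u v : 'I_N -> 'cV[R]_n) :
  dotv (\mxcol_i u i) (\mxcol_i v i) = \sum_k dotv (slice u k) (slice v k).
Proof.
rewrite dotv_mxcol; under eq_bigr do rewrite dotvE.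
rewrite exchange_big; apply: eq_bigr => k _; rewrite dotvE.
by apply: eq_bigr => i _; rewrite !mxE.
Qed.

Lemma quadform_blockwise n (L : 'M[R]_N) (u : 'I_N -> 'cV[R]_n) :
  dotv (\mxcol_i u i) (blockwise n L *m \mxcol_i u i) =
  \sum_k dotv (slice u k) (L *m slice u k).
Proof.
rewrite mul_blockwise dotv_slice.
by apply: eq_bigr => k _; rewrite slice_blockwise.
Qed.

Lemma psd_blockwise n (L : 'M[R]_N) :
  possemidefmx L -> possemidefmx (blockwise n L).
Proof.
move=> pL; apply: psdP => [|v]; first by rewrite tr_blockwise (proj1 pL).
rewrite -(submxcolK v) quadform_blockwise.
by apply: sumr_ge0 => k _; exact: psd_ge0.
Qed.

Lemma blockwise_quadform_le n (L : 'M[R]_N) s v :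
  (forall w, dotv w (L *m w) <= s * sqnorm w) ->
  dotv v (blockwise n L *m v) <= s * sqnorm v.
Proof.
move=> Ls; rewrite -(submxcolK v) quadform_blockwise /sqnorm dotv_slice.
by rewrite mulr_sumr; apply: ler_sum => k _; exact: Ls.
Qed.

End Stacked.

(** * Graph Laplacians *)

Section Laplacian.
Variables (R : realType) (N : nat) (a : 'I_N -> 'I_N -> R).

Hypotheses (ha : weighted_graph a) (hundir : undirected a).

Lemma laplacian_action (E : lmodType R) (u : 'I_N -> E) i :
  \sum_j laplacian a i j *: u j = \sum_j a i j *: (u i - u j).
Proof.
under [RHS]eq_bigr do rewrite scalerBr; rewrite sumrB -scaler_suml.
rewrite (bigD1 i)//= mxE eqxx [X in _ = _ - X](bigD1 i isT)/= (proj2 ha) scale0r.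
rewrite add0r -sumrN; congr (_ + _); apply: eq_bigr => j ji.
by rewrite mxE eq_sym (negbTE ji) scaleNr.
Qed.

Lemma tr_laplacian : (laplacian a)^T = laplacian a.
Proof.
apply/matrixP => i j; rewrite !mxE eq_sym hundir.
by case: eqVneq => // ->.
Qed.

(** Each edge is visited from both ends, hence the factor 2. *)
Lemma quadform_laplacian (x : 'cV[R]_N) :
  2 * dotv x (laplacian a *m x) =
  \sum_i \sum_j a i j * (x i 0 - x j 0) ^+ 2.
Proof.
have -> : dotv x (laplacian a *m x) =
    \sum_i \sum_j a i j * (x i 0 * (x i 0 - x j 0)).
  rewrite dotvE; apply: eq_bigr => i _; rewrite mxE.
  have /= -> := laplacian_action (fun j => x j 0 : R^o) i.
  by rewrite mulr_sumr; apply: eq_bigr => j _; rewrite mulrCA.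
rewrite mulr_natl mulr2n [X in _ + X]exchange_big -big_split.
apply: eq_bigr => i _; rewrite -big_split; apply: eq_bigr => j _ /=.
by rewrite (hundir j i); ring.
Qed.

Lemma psd_laplacian : possemidefmx (laplacian a).
Proof.
apply: psdP => [|x]; first exact: tr_laplacian.
rewrite -(pmulr_rge0 _ (ltr0n R 2)) quadform_laplacian.
by do 2!apply: sumr_ge0 => ? _; rewrite mulr_ge0 ?sqr_ge0// (proj1 ha).
Qed.

(** A vector in the kernel has zero energy on every edge, so it is constant
    along every path. *)
Lemma laplacian_ker (x : 'cV[R]_N) : graph_connected a ->
  laplacian a *m x = 0 -> forall i j, x i 0 = x j 0.
Proof.
move=> hconn Lx0.
have ge i j : 0 <= a i j * (x i 0 - x j 0) ^+ 2.
  by rewrite mulr_ge0 ?sqr_ge0// (proj1 ha).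
have /eqP := quadform_laplacian x; rewrite Lx0 {1}/dotv mulmx0 mxE mulr0 eq_sym.
rewrite psumr_eq0 => [|i _]; last by apply: sumr_ge0 => j _; exact: ge.
move=> /allP sum0.
have edge i j : 0 < a i j -> x i 0 = x j 0.
  move=> aij; have := sum0 i (mem_index_enum _).
  rewrite psumr_eq0// => /allP /(_ j (mem_index_enum _)).
  by rewrite mulf_eq0 gt_eqF//= sqrf_eq0 subr_eq0 => /eqP.
move=> i j; have /connectP[p] := hconn i j.
elim: p i => [|k p IH] i /=; first by move=> _ ->.
by move=> /andP[/edge -> kp] /(IH _ kp).
Qed.

Lemma blockwise_laplacian_ker n (u : 'I_N -> 'cV[R]_n) : graph_connected a ->
  blockwise n (laplacian a) *m \mxcol_i u i = 0 -> forall i j, u i = u j.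
Proof.
move=> hconn; rewrite mul_blockwise => Lu0 i j.
apply/matrixP => k h; rewrite (ord1 h).
have : laplacian a *m slice u k = 0.
  rewrite -slice_blockwise; apply/matrixP => r h'; rewrite !mxE.
  have /(congr1 (fun v => submxcol v r)) := Lu0.
  by rewrite mxcolK submxcol0 => ->; rewrite mxE.
by move=> /(laplacian_ker hconn) /(_ i j); rewrite !mxE.
Qed.

(** The columns of a Laplacian sum to 0: by symmetry they are its rows. *)
Lemma laplacian_sum0 (E : lmodType R) (u : 'I_N -> E) :
  \sum_i \sum_j laplacian a i j *: u j = 0.
Proof.
rewrite exchange_big; apply: big1 => j _; rewrite -scaler_suml.
suff -> : \sum_i laplacian a i j = 0 by rewrite scale0r.
have := laplacian_action (fun=> 1 : R^o) j; rewrite /= [RHS]big1 => [|i _].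
  move=> {2}<-; apply: eq_bigr => i _.
  by rewrite -[in LHS]tr_laplacian mxE [RHS]mulr1.
by rewrite subrr scaler0.
Qed.

End Laplacian.

(** * Information matrices and the least-squares problem *)

Section Information.
Variables (R : realType) (m n : nat).
Implicit Types (H : 'M[R]_(m, n)) (V : 'M[R]_m) (P : 'M[R]_n).

Lemma pd_block V P : posdefmx V -> posdefmx P -> posdefmx (block_mx V 0 0 P).
Proof.
move=> pV pP; apply: pd_of_psd_unit; last first.
  by rewrite block_diag_mx_unit !pd_unit.
apply: psdP => [|v].
  by rewrite tr_block_mx !trmx0 (proj1 pV) (proj1 pP).
rewrite -(vsubmxK v) mul_block_col !mul0mx addr0 add0r /dotv tr_col_mx.
rewrite mul_row_col mxE; apply: addr_ge0; exact/psd_ge0/pd_psd.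
Qed.

Lemma mul_stacked_inv H V P (y : 'cV[R]_m) (x : 'cV[R]_n) :
  posdefmx V -> posdefmx P ->
  (col_mx H 1%:M)^T *m (invmx (block_mx V 0 0 P) *m col_mx y x) =
  H^T *m invmx V *m y + invmx P *m x.
Proof.
move=> pV pP; rewrite invmx_block_diag ?block_diag_mx_unit ?pd_unit//.
rewrite mul_block_col !mul0mx addr0 add0r tr_col_mx mul_row_col trmx1 mul1mx.
by rewrite mulmxA.
Qed.

Lemma information_stackedE H V P : posdefmx V -> posdefmx P ->
  (col_mx H 1%:M)^T *m invmx (block_mx V 0 0 P) *m col_mx H 1%:M =
  H^T *m invmx V *m H + invmx P.
Proof.
move=> pV pP; rewrite invmx_block_diag ?block_diag_mx_unit ?pd_unit//.
rewrite tr_col_mx mul_row_block !mulmx0 addr0 add0r mul_row_col.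
by rewrite trmx1 mul1mx mulmx1.
Qed.

Lemma pd_information H V P : posdefmx V -> posdefmx P ->
  posdefmx (H^T *m invmx V *m H + invmx P).
Proof.
move=> pV pP; have pVi := pd_inv pV; have pPi := pd_inv pP; apply: pdP.
  by rewrite linearD/= !trmx_mul trmxK (proj1 pVi) (proj1 pPi) mulmxA.
move=> v v0; rewrite mulmxDl dotvDr ltr_wpDl ?pd_gt0//.
by rewrite -!mulmxA -dotv_mull psd_ge0//; exact: pd_psd.
Qed.

(** Completing the square: at the estimate the stacked residual is
    [S^-1]-orthogonal to the range of [[H; I]] (the normal equations), so the
    excess cost at [x] is half the information form at [x] minus the
    estimate. *)
Lemma ckf_minimizer_estimate H V P y xp x : posdefmx V -> posdefmx P ->
  ckf_minimizer H V P y xp x <-> x = ckf_estimate H V P y xp.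
Proof.
move=> pV pP; set xh := ckf_estimate _ _ _ _ _.
set W := H^T *m invmx V *m H + invmx P.
have pW : posdefmx W by exact: pd_information.
set S := block_mx V 0 0 P; set Hc := col_mx H 1%:M.
have pS : posdefmx (invmx S) by exact/pd_inv/pd_block.
have normal_eq : Hc^T *m (invmx S *m (col_mx y xp - Hc *m xh)) = 0.
  rewrite mul_col_mx mul1mx opp_col_mx add_col_mx mul_stacked_inv//.
  have -> : y - H *m xh = (y - H *m xp) - H *m (xh - xp).
    by rewrite mulmxBr opprB addrA subrK.
  have -> : xp - xh = - (xh - xp) by rewrite opprB.
  rewrite mulmxBr mulmxN mulmxA -addrA -opprD -mulmxDl -/W /xh /ckf_estimate.
  rewrite addrAC subrr add0r /ckf_gain -/W !mulmxA mulmxV ?pd_unit// mul1mx.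
  by rewrite subrr.
have cost z : ckf_cost H V P y xp z =
    ckf_cost H V P y xp xh + 2^-1 * dotv (z - xh) (W *m (z - xh)).
  rewrite /ckf_cost -/S -/Hc !quadformE -[in LHS](subrK xh z).
  rewrite (addrC (z - xh)) mulmxDr opprD addrA.
  set r := col_mx y xp - _; set d := Hc *m _.
  have dr : dotv d (invmx S *m r) = 0.
    by rewrite dotv_mull normal_eq /dotv mulmx0 mxE.
  have rd : dotv r (invmx S *m d) = 0.
    by rewrite -[in LHS](proj1 pS) -dotv_mull dotvC.
  have -> : dotv (z - xh) (W *m (z - xh)) = dotv d (invmx S *m d).
    by rewrite /W -information_stackedE// -!mulmxA -dotv_mull.
  by clearbody r d; rewrite mulmxBr !dotv_lin dr rd; ring.
split=> [minx|-> z]; last first.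
  by rewrite (cost z) lerDl mulr_ge0 ?psd_ge0//; exact: pd_psd.
apply/eqP; rewrite -subr_eq0; apply/negP => /negP d0.
have := minx xh; rewrite (cost x) gerDl leNgt.
by rewrite mulr_gt0 ?pd_gt0// invr_gt0.
Qed.

End Information.

Section SensorNetwork.
Variables (R : realType) (N n : nat) (m_ : 'I_N -> nat).
Variables (H : forall i : 'I_N, 'M[R]_(m_ i, n)) (V : forall i, 'M[R]_(m_ i)).
Variables (P : 'M[R]_n).
Hypotheses (N0 : (0 < N)%N) (pV : forall i, posdefmx (V i)).
Hypothesis pP : posdefmx P.

Let N0R : N%:R != 0 :> R.
Proof. by rewrite pnatr_eq0 -lt0n. Qed.

Lemma pd_scaled_prediction : posdefmx (N%:R *: P).
Proof.
apply: pdP => [|v v0]; first by rewrite linearZ/= (proj1 pP).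
by rewrite -scalemxAl dotvZr mulr_gt0 ?ltr0n ?pd_gt0.
Qed.

Lemma local_infoE i :
  local_info N (H i) (V i) P =
  (H i)^T *m invmx (V i) *m H i + invmx (N%:R *: P).
Proof. by rewrite invmxZ// pd_unit//; exact: pd_scaled_prediction. Qed.

Lemma local_info_stackedE i :
  (Hbar (H i))^T *m invmx (Sbar N (V i) P) *m Hbar (H i) =
  local_info N (H i) (V i) P.
Proof.
by rewrite local_infoE information_stackedE//; exact: pd_scaled_prediction.
Qed.

Lemma pd_local_info i : posdefmx (local_info N (H i) (V i) P).
Proof.
rewrite local_infoE; apply: pd_information => //; exact: pd_scaled_prediction.
Qed.

(** The [N] shares [P^-1 / N] of the prior add up to one. *)
Lemma sum_local_info :
  \sum_i local_info N (H i) (V i) P =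
  (\mxcol_i H i)^T *m invmx (\mxdiag_i V i) *m \mxcol_i H i + invmx P.
Proof.
rewrite big_split/= sumr_const card_ord -scaler_nat scalerA mulfV// scale1r.
rewrite invmx_mxdiag => [|i]; last exact: pd_unit.
by rewrite tr_mxcol mul_mxrow_mxdiag mul_mxrow_mxcol.
Qed.

(** The centralized estimate is the information-weighted mean of the local
    ones. *)
Lemma ckf_estimate_fusion (y : forall i, 'cV[R]_(m_ i)) (xp : 'cV[R]_n) :
  \sum_i local_info N (H i) (V i) P *m
    (xp + local_gain N (H i) (V i) P *m (y i - H i *m xp)) =
  (\sum_i local_info N (H i) (V i) P) *m
    ckf_estimate (\mxcol_i H i) (\mxdiag_i V i) P (\mxcol_i y i) xp.
Proof.
pose r i := y i - H i *m xp.
have local i : local_info N (H i) (V i) P *m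
      (xp + local_gain N (H i) (V i) P *m r i) =
    local_info N (H i) (V i) P *m xp + (H i)^T *m invmx (V i) *m r i.
  by rewrite mulmxDr !mulmxA mulmxV ?mul1mx//; exact/pd_unit/pd_local_info.
rewrite (eq_bigr _ (fun i _ => local i)) [LHS]big_split/= -mulmx_suml.
rewrite /ckf_estimate mulmxDr /ckf_gain -sum_local_info; congr (_ + _).
rewrite !mulmxA mulmxV ?mul1mx; last first.
  rewrite sum_local_info; apply/pd_unit/pd_information => //.
  exact: pd_mxdiag.
rewrite invmx_mxdiag => [|i]; last exact: pd_unit.
by rewrite mxcol_mul -mxcolB tr_mxcol mul_mxrow_mxdiag mul_mxrow_mxcol.
Qed.

End SensorNetwork.

(** * Dual ascent *)

Section DualAscent.
Variables (R : realType) (n : nat) (K D : 'M[R]_n) (c : 'cV[R]_n).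
Hypotheses (sK : K^T = K) (pD : posdefmx D).

(** The dual function has gradient [K (c - D K lam)], hence Hessian
    [- K D K]. A maximiser can be reached from any start by a correction in the
    range of the Hessian. *)
Lemma dual_optimum (lam0 : 'cV[R]_n) :
  exists g, K *m D *m K *m (lam0 - K *m D *m K *m g) = K *m c.
Proof.
have sM : (K *m D *m K)^T = K *m D *m K.
  by rewrite !trmx_mul sK (proj1 pD) mulmxA.
have [v Mv0|X KX] := sym_ker_factor sK sM; last first.
  have [g gE] := range_correction lam0 (X *m c) sM.
  by exists g; rewrite gE mulmxA -KX.
apply/eqP/negP => /negP Kv0; have := pd_gt0 pD Kv0.
by rewrite dotv_mull sK 2!mulmxA Mv0 /dotv mulmx0 mxE ltxx.
Qed.

(** The constant of [gradient_iteration_cvg] for [M = K D K]: one factor [s^2]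
    from [|K w|^2 <= s^2 |w|^2] and one factor [d] from [D^2 <= d D]. *)
Lemma dual_ascent_cvg (s d alpha : R) (g : 'cV[R]_n) (lam : nat -> 'cV[R]_n) :
  possemidefmx K ->
  (forall v, dotv v (K *m v) <= s * sqnorm v) -> 0 <= s ->
  (forall v, dotv v (D *m v) <= d * sqnorm v) ->
  0 < alpha -> alpha * (s ^+ 2 * d) < 2 ->
  (forall l, lam l.+1 = lam l + alpha *: (K *m (c - D *m (K *m lam l)))) ->
  K *m D *m K *m (lam 0%N - K *m D *m K *m g) = K *m c ->
  sqnorm (lam l - (lam 0%N - K *m D *m K *m g)) @[l --> \oo] --> 0.
Proof.
move=> pK Ks s0 Dd alpha0 alphasd lamS gE.
have qM v : dotv v (K *m (D *m (K *m v))) = dotv (K *m v) (D *m (K *m v)).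
  by rewrite [RHS]dotv_mull sK.
have pM : possemidefmx (K *m D *m K).
  apply: psdP => [|v]; first by rewrite !trmx_mul sK (proj1 pD) mulmxA.
  by rewrite -!mulmxA qM psd_ge0//; exact: pd_psd.
apply: (gradient_iteration_cvg pM _ alpha0 alphasd _ gE) => [v|l]; last first.
  by rewrite lamS mulmxBr !mulmxA.
have sqK w : sqnorm (K *m w) <= s ^+ 2 * sqnorm w.
  apply: le_trans (psd_sqnorm_le w pK Ks) _.
  by rewrite expr2 -mulrA ler_wpM2l.
rewrite -!mulmxA; apply: le_trans (sqK _) _.
rewrite -mulrA ler_wpM2l ?sqr_ge0// qM.
exact: psd_sqnorm_le (pd_psd pD) Dd.
Qed.

End DualAscent.

Theorem lemma2 (R : realType) (N n : nat) (hN : (2 <= N)%N)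
    (m_ : 'I_N -> nat)
    (F Q : 'M[R]_n) (H : forall i : 'I_N, 'M[R]_(m_ i, n))
    (V : forall i : 'I_N, 'M[R]_(m_ i))
    (hQ : possemidefmx Q) (hV : forall i : 'I_N, posdefmx (V i))
    (hobs : observable F (\mxcol_(i < N) H i))
    (P : 'M[R]_n) (xpred : 'cV[R]_n) (hP : posdefmx P)
    (Ploc : 'I_N -> 'M[R]_n) (xloc : 'I_N -> 'cV[R]_n)
    (hPloc : forall i : 'I_N, Ploc i = P)
    (hxloc : forall i : 'I_N, xloc i = xpred)
    (y : forall i : 'I_N, 'cV[R]_(m_ i))
    (a : 'I_N -> 'I_N -> R) (ha : weighted_graph a)
    (hundir : undirected a) (hconn : graph_connected a)
    (sigma : R) (hsigma : max_eigenvalue (laplacian a) sigma) :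
  let Hs := \mxcol_(i < N) H i in
  let Vs := \mxdiag_(i < N) V i in
  let ys := \mxcol_(i < N) y i in
  let xhat := ckf_estimate Hs Vs P ys xpred in
  (forall x : 'cV[R]_n, ckf_minimizer Hs Vs P ys xpred x <-> x = xhat) /\
  exists lam_lim : ('I_N -> 'cV[R]_n) -> 'I_N -> 'cV[R]_n,
    forall alpha : R, 0 < alpha -> alpha < step_bound H V Ploc sigma ->
    forall (lam0 : 'I_N -> 'cV[R]_n) (xi lam : 'I_N -> nat -> 'cV[R]_n),
      (forall i : 'I_N, lam i 0%N = lam0 i) ->
      dual_ascent a H V Ploc xloc y alpha xi lam ->
      (forall i : 'I_N, xi i l @[l --> \oo] --> xhat) /\
      (forall i : 'I_N, lam i l @[l --> \oo] --> lam_lim lam0 i).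
Proof.
have {hPloc}-> : Ploc = fun=> P by apply/funext.
have {hxloc}-> : xloc = fun=> xpred by apply/funext.
move=> Hs Vs ys xhat; split=> [x|].
  by apply: ckf_minimizer_estimate => //; exact: pd_mxdiag.
have N0 : (0 < N)%N by exact: leq_trans hN.
pose A i := local_info N (H i) (V i) P.
have pA i : posdefmx (A i) by exact: pd_local_info.
pose K := blockwise n (laplacian a).
pose D := \mxdiag_(i < N) invmx (A i).
pose c i := xpred + local_gain N (H i) (V i) P *m (y i - H i *m xpred).
have pL := psd_laplacian ha hundir.
have pK : possemidefmx K by exact: psd_blockwise.
have pD : posdefmx D by apply: pd_mxdiag => i; exact: pd_inv.
have [g gE] := choice (fun lam0 : 'I_N -> 'cV[R]_n =>
  dual_optimum (\mxcol_i c i) (proj1 pK) pD (\mxcol_i lam0 i)).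
pose opt lam0 := \mxcol_i lam0 i - K *m D *m K *m g lam0.
exists (fun lam0 i => submxcol (opt lam0) i) => alpha alpha0 alphalt.
move=> lam0 xi lam lam00 [xiS lamS].
pose Lam l := \mxcol_(i < N) lam i l.
pose Xi l := \mxcol_(i < N) xi i l.
have Lam0 : Lam 0%N = \mxcol_i lam0 i by apply: eq_mxcol => i; rewrite lam00.
(* Absent edges have weight 0, so neighbour sums are Laplacian rows. *)
have neighbours (u : 'I_N -> 'cV[R]_n) i :
    \sum_(j < N | 0 < a i j) a i j *: (u i - u j) =
    \sum_j laplacian a i j *: u j.
  rewrite laplacian_action// [LHS]big_mkcond; apply: eq_bigr => j _.
  have := proj1 ha i j; rewrite le_eqVlt => /orP[/eqP<-|->//].
  by rewrite ltxx scale0r.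
have XiS l : Xi l.+1 = \mxcol_i c i - D *m (K *m Lam l).
  rewrite mul_blockwise mul_mxdiag_mxcol -mxcolB; apply: eq_mxcol => i.
  by rewrite xiS (neighbours (lam^~ l)).
have LamS l : Lam l.+1 = Lam l + alpha *: (K *m Xi l.+1).
  rewrite mul_blockwise -mxcolZ -mxcolD; apply: eq_mxcol => i.
  by rewrite lamS (neighbours (xi^~ l.+1)).
pose d := \big[Num.max/0]_(i < N) spectral_norm (invmx (A i)).
have alpha2 : alpha * (sigma ^+ 2 * d) < 2.
  move: alphalt; rewrite /step_bound.
  under eq_bigr do rewrite local_info_stackedE//.
  rewrite -/d => lt_alpha; rewrite -ltr_pdivlMr//.
  by have := lt_trans alpha0 lt_alpha; rewrite pmulr_rgt0// invr_gt0.
have D_le v : dotv v (D *m v) <= d * sqnorm v.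
  rewrite quadform_mxdiag -{3}(submxcolK v) /sqnorm dotv_mxcol mulr_sumr.
  apply: ler_sum => i _; apply: le_trans (quadform_le_spectral_norm _ _) _.
  by rewrite ler_wpM2r ?sqnorm_ge0//; exact: le_bigmax.
have K_le v : dotv v (K *m v) <= sigma * sqnorm v.
  apply: blockwise_quadform_le => w.
  by apply: quadform_le_max_eigenvalue hsigma; exact: proj1 pL.
have LamRec l :
    Lam l.+1 = Lam l + alpha *: (K *m (\mxcol_i c i - D *m (K *m Lam l))).
  by rewrite LamS XiS.
have gE0 : K *m D *m K *m (Lam 0%N - K *m D *m K *m g lam0) =
    K *m \mxcol_i c i by rewrite Lam0; exact: gE.
have Lam_cvg : sqnorm (Lam l - opt lam0) @[l --> \oo] --> 0.
  rewrite /opt -Lam0.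
  exact: (dual_ascent_cvg (proj1 pK) pD pK K_le
    (max_eigenvalue_ge0 pL hsigma) D_le alpha0 alpha2 LamRec gE0).
pose xinf := \mxcol_i c i - D *m (K *m opt lam0).
have xinfD : xinf = \mxcol_i c i - D *m (K *m opt lam0) by [].
(* Consensus and the fusion equation identify every block of the limit. *)
have xinfE i : submxcol xinf i = xhat.
  have Kx0 : K *m xinf = 0.
    by rewrite mulmxBr !mulmxA /opt gE subrr.
  have cons j k : submxcol xinf j = submxcol xinf k.
    by apply: (blockwise_laplacian_ker ha hundir hconn); rewrite submxcolK.
  have Ax j : A j *m submxcol xinf j =
      A j *m c j - \sum_k laplacian a j k *: submxcol (opt lam0) k.
    rewrite /xinf -{1}(submxcolK (opt lam0)) mul_blockwise mul_mxdiag_mxcol.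
    by rewrite -mxcolB mxcolK mulmxBr mulKVmx// pd_unit.
  have WE : \sum_j A j = Hs^T *m invmx Vs *m Hs + invmx P.
    exact: sum_local_info.
  have uW : \sum_j A j \in unitmx.
    by rewrite WE; apply/pd_unit/pd_information => //; exact: pd_mxdiag.
  rewrite -[LHS](mulKmx uW) -[RHS](mulKmx uW); congr (_ *m _).
  rewrite -ckf_estimate_fusion// mulmx_suml.
  under eq_bigr => j _ do rewrite (cons i j) Ax.
  by rewrite sumrB laplacian_sum0// subr0.
clearbody xinf; split=> i; last first.
  apply: cvg_of_sqnorm.
  have := sqnorm_submxcol_cvg0 i Lam_cvg.
  by under eq_fun do rewrite submxcolB mxcolK.
have step l : sqnorm (xi i l.+1 - submxcol xinf i) =
    sqnorm (submxcol (D *m K *m (Lam l - opt lam0)) i).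
  have -> : D *m K *m (Lam l - opt lam0) = xinf - Xi l.+1.
    rewrite -mulmxA 2!mulmxBr XiS xinfD [RHS]addrC [X in _ = X + _]opprB.
    by rewrite [RHS]addrA subrK.
  by rewrite submxcolB mxcolK -[LHS]sqnormN opprB.
rewrite -(cvg_shiftS (xi i)) -(xinfE i); apply: cvg_of_sqnorm.
under eq_fun do rewrite step.
exact: sqnorm_submxcol_cvg0 (sqnorm_mulmx_cvg0 _ Lam_cvg).
Qed.
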